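(* The Poisson kernels $P_p(z,w)$ converge to the Cauchy-Hua kernel $H(z,w)$ almost uniformly (i.e. uniformly on every compact subset) on $$LD:=\{(z,w)\in\mathbb{C}^n\times\mathbb{C}^n: L(z)L(w)<1\}$$ as $p$ tends to infinity.
   Context: $n$ is a positive integer. For $z,w\in\mathbb{C}^n$: $z\cdot w=\sum_jz_jw_j$ (bilinear), $z^2=z\cdot z$, $\overline{w}$ is the componentwise complex conjugate, $\overline{w}^2=\overline{w}\cdot\overline{w}$, $\|z\|=(\sum_j|z_j|_{\mathbb{C}}^2)^{1/2}$ is the Hermitian norm, and $L(z)=\sqrt{\|z\|^2+\sqrt{\|z\|^4-|z^2|_{\mathbb{C}}^2}}$, where $|\cdot|_{\mathbb{C}}$ is the modulus of a complex number. The Cauchy-Hua kernel is $H(z,w)=\dfrac{1}{(\overline{w}^2z^2-2\overline{w}\cdot z+1)^{n/2}}$ on $LD$, where the power with exponent $n/2$ is the $n$-th power of the principal square root. For an integer $p\ge1$ the Poisson kernel on $LD$ is $$P_p(z,w)=\frac{1-(z^2\overline{w}^2)^p}{(\overline{w}^2z^2-2\overline{w}\cdot z+1)^{n/2}}=(1-(z^2\overline{w}^2)^p)H(z,w).$$ *)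

(* Defs.v *)
From HB Require Import structures.
From mathcomp Require Import all_boot all_order all_algebra.
From mathcomp Require Import complex.
From mathcomp Require Import all_classical all_reals all_analysis.

Set Implicit Arguments.
Unset Strict Implicit.
Unset Printing Implicit Defensive.

Import Order.TTheory GRing.Theory Num.Theory.
Import numFieldNormedType.Exports.

Local Open Scope classical_set_scope.
Local Open Scope ring_scope.
Local Open Scope complex_scope.

(* The modulus topology, which every numFieldType carries through _^o, is not
   found by unification on the concrete type R[i]; declare it here, as the
   library does for the abstract field structures. *)
HB.instance Definition _ (R : rcfType) := GRing.ComAlgebra.copy R[i] R[i]^o.
HB.instance Definition _ (R : rcfType) := Vector.copy R[i] R[i]^o.
HB.instance Definition _ (R : rcfType) := NormedModule.copy R[i] R[i]^o.

Section LieBall.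
Variables (R : realType) (n : nat).
Implicit Types z w : 'rV[R[i]]_n.

Definition dot z w : R[i] := \sum_(j < n) z 0 j * w 0 j.

Definition cconj w : 'rV[R[i]]_n := map_mx (@conjc R) w.

(* `|z| on a matrix is the sup norm, and the norm of R[i] is R[i]-valued;
   Normc.normc is the real-valued modulus. *)
Definition hnorm z : R := Num.sqrt (\sum_(j < n) Normc.normc (z 0 j) ^+ 2).

Definition L z : R :=
  Num.sqrt (hnorm z ^+ 2
            + Num.sqrt (hnorm z ^+ 4 - Normc.normc (dot z z) ^+ 2)).

Definition LD : set ('rV[R[i]]_n * 'rV[R[i]]_n) :=
  [set zw | L zw.1 * L zw.2 < 1].

(* sqrtc is the principal root (nonnegative real part); the generic sqrtC of
   numClosedFieldType instead picks the root with nonnegative imaginary part. *)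
Definition kernel_denom z w : R[i] :=
  sqrtc (dot (cconj w) (cconj w) * dot z z - 2 * dot (cconj w) z + 1) ^+ n.

Definition cauchy_hua z w : R[i] := 1 / kernel_denom z w.

Definition poisson (p : nat) z w : R[i] :=
  (1 - (dot z z * dot (cconj w) (cconj w)) ^+ p) / kernel_denom z w.

End LieBall.

(* Main.v *)
Require Import Defs.
From mathcomp Require Import all_boot all_order all_algebra.
From mathcomp Require Import complex ring lra.
From mathcomp Require Import all_classical all_reals all_analysis.

(** The difference of the two kernels is [s ^+ p / D ^+ n], where
    [s = z^2 * conj w^2] and [D] is the principal square root of
    [f(z, w) = conj w^2 * z^2 - 2 (conj w . z) + 1].  On a compact subset of
    the domain the continuous functions [|s|] and [|f|] attain their extrema,
    so the convergence is uniform and geometric as soon as [|s| < 1] and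
    [f <> 0] at every point.  The first bound ([normc_ratio_lt1]) is
    immediate: [|z^2| <= ||z||^2 <= L(z)^2].

    The substance is [f <> 0] ([denom_base_neq0]).  Write [a = ||z||^2],
    [c = ||w||^2], [t = z . conj w], and
    [alpha = sqrt (a^2 - |z^2|^2)], [gamma = sqrt (c^2 - |w^2|^2)], so that
    [L(z)^2 = a + alpha] and [L(w)^2 = c + gamma].  Two estimates of the same
    number [z . w] are compared.  Projecting [w] and [conj z] on the
    orthogonal complement of [z] and applying the Cauchy-Schwarz inequality
    there gives
    [|a (z . w) - z^2 conj t| <= alpha sqrt (a c - |t|^2)], and exchanging
    [z] and [w] gives [|c (z . w) - w^2 t| <= gamma sqrt (a c - |t|^2)].
    Eliminating [z . w] by the triangle inequality and squaring
    ([dot_cross_le]) yields, with [m = a c + alpha gamma] and after division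
    by [a c],
    [2 m |t|^2 - 2 Re (s (conj t)^2) <= m^2 - |s|^2].
    If [f = 0] then [2 t = 1 + s], and this inequality factors as
    [0 <= (2 m - (1 + |s|^2)) (m - Re s)].  The first factor is negative when
    [L(z) L(w) < 1], and the second one is nonnegative because
    [Re s <= a c <= m]; the case [m = Re s] is excluded by [|t|^2 <= a c]
    ([quadric_gap]). *)

Set Implicit Arguments.
Unset Strict Implicit.

Import Order.TTheory GRing.Theory Num.Theory.
Import numFieldNormedType.Exports.

Local Open Scope classical_set_scope.
Local Open Scope ring_scope.
Local Open Scope complex_scope.

(** * The modulus of a complex number *)

Section Modulus.
Variable R : realType.
Implicit Types x y : R[i].
Local Notation normc := (@Normc.normc R).

Lemma normc_ge0 x : 0 <= normc x.
Proof. by case: x => a b; apply: sqrtr_ge0. Qed.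

Lemma sqr_normcJ x : (normc x ^+ 2)%:C = x * x^*%C.
Proof.
case: x => a b; rewrite sqr_sqrtr ?addr_ge0 ?sqr_ge0 //.
by apply/eqP; rewrite eq_complex /=; apply/andP; split; apply/eqP; ring.
Qed.

Lemma sqr_normcE x : normc x ^+ 2 = complex.Re x ^+ 2 + complex.Im x ^+ 2.
Proof. by case: x => a b; rewrite sqr_sqrtr // addr_ge0 ?sqr_ge0. Qed.

Lemma normc_conj x : normc x^*%C = normc x.
Proof. by case: x => a b; rewrite /= sqrrN. Qed.

Lemma sqr_normcB x y :
  normc (x - y) ^+ 2 =
  normc x ^+ 2 + normc y ^+ 2 - 2 * complex.Re (x * y^*%C).
Proof. by case: x y => [a b] [c d]; rewrite !sqr_normcE /=; ring. Qed.

Lemma normc_real (r : R) : 0 <= r -> normc r%:C = r.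
Proof. by move=> r0; rewrite /= expr0n addr0 sqrtr_sqr ger0_norm. Qed.

Lemma normcX x k : normc (x ^+ k) = normc x ^+ k.
Proof.
by elim: k => [|k IH]; rewrite ?Normc.normc1 // !exprS Normc.normcM IH.
Qed.

Lemma lerB_normc x y : normc x - normc y <= normc (x - y).
Proof. by rewrite lerBlDr; have := le_normcD (x - y) y; rewrite subrK. Qed.
End Modulus.

(** * Hermitian geometry and the Lie norm *)

Section Herm.
Variables (R : realType) (n : nat).
Implicit Types (x y : R[i]) (u v w z : 'rV[R[i]]_n).
Local Notation normc := (@Normc.normc R).
Local Notation herm u v := (dot u (cconj v)).

Lemma dotC u v : dot u v = dot v u.
Proof. by apply: eq_bigr => j _; rewrite mulrC. Qed.

Lemma dotBZl x y u v w :
  dot (x *: u - y *: v) w = x * dot u w - y * dot v w.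
Proof.
rewrite /dot !mulr_sumr -sumrB; apply: eq_bigr => j _.
by rewrite !mxE; ring.
Qed.

Lemma dotBZr x y u v w :
  dot w (x *: u - y *: v) = x * dot w u - y * dot w v.
Proof. by rewrite dotC dotBZl !(dotC w). Qed.

Lemma cconjBZ x y u v :
  cconj (x *: u - y *: v) = x^*%C *: cconj u - y^*%C *: cconj v.
Proof. by apply/rowP => j; rewrite !mxE rmorphB !rmorphM. Qed.

Lemma cconjK u : cconj (cconj u) = u.
Proof. by apply/rowP => j; rewrite !mxE conjcK. Qed.

Lemma dotJ u v : (dot u v)^*%C = dot (cconj u) (cconj v).
Proof.
by rewrite /dot rmorph_sum; apply: eq_bigr => j _; rewrite rmorphM !mxE.
Qed.

Lemma sqr_hnormE u : hnorm u ^+ 2 = \sum_(j < n) normc (u 0 j) ^+ 2.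
Proof. by rewrite sqr_sqrtr //; apply: sumr_ge0 => j _; rewrite sqr_ge0. Qed.

Lemma hermE u : herm u u = (hnorm u ^+ 2)%:C.
Proof.
rewrite sqr_hnormE rmorph_sum; apply: eq_bigr => j _.
by rewrite /= sqr_normcJ !mxE.
Qed.

Lemma hermJ u v : (herm u v)^*%C = herm v u.
Proof. by rewrite dotJ cconjK dotC. Qed.

Lemma hnorm_cconj u : hnorm (cconj u) = hnorm u.
Proof. by congr Num.sqrt; apply: eq_bigr => j _; rewrite !mxE normc_conj. Qed.

Lemma hnorm_ge0 u : 0 <= hnorm u.
Proof. exact: sqrtr_ge0. Qed.

Lemma hnorm_eq0 u : hnorm u = 0 -> u = 0.
Proof.
move=> u0; apply/rowP => j; rewrite mxE; apply: Normc.eq0_normc.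
have : hnorm u ^+ 2 == 0 by rewrite u0 expr0n.
rewrite sqr_hnormE psumr_eq0 => [/allP/(_ j)|i _]; last exact: sqr_ge0.
by rewrite mem_index_enum sqrf_eq0 => /(_ isT)/eqP.
Qed.

Lemma dot0l u : dot 0 u = 0.
Proof. by apply: big1 => j _; rewrite mxE mul0r. Qed.

Lemma herm0r u : herm u 0 = 0.
Proof. by rewrite /cconj map_mx0 dotC dot0l. Qed.

(** Scaling the orthogonal projection of [v] on the complement of [u] by
    [||u||^2] keeps the computation free of divisions. *)
Lemma herm_orth u v w (a := (hnorm u ^+ 2)%:C) :
  herm (a *: v - herm v u *: u) (a *: w - herm w u *: u) =
  a * (a * herm v w - herm v u * herm u w).
Proof.
by rewrite cconjBZ dotBZr !dotBZl hermE hermJ conjc_real -/a; ring.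
Qed.

Lemma hnorm_orth u v :
  hnorm ((hnorm u ^+ 2)%:C *: v - herm v u *: u) ^+ 2 =
  hnorm u ^+ 2 * (hnorm u ^+ 2 * hnorm v ^+ 2 - normc (herm v u) ^+ 2).
Proof.
apply: complexI; rewrite -[LHS]hermE herm_orth hermE.
by rewrite -(hermJ v u) -sqr_normcJ -rmorphM -rmorphB -rmorphM.
Qed.

(** [||v||^2] times the difference of the two sides is the squared norm of the
    scaled component of [u] orthogonal to [v]. *)
Lemma cauchy_schwarz u v : normc (herm u v) ^+ 2 <= hnorm u ^+ 2 * hnorm v ^+ 2.
Proof.
have [/hnorm_eq0->|v0] := eqVneq (hnorm v) 0.
  by rewrite herm0r Normc.normc0 expr0n mulr_ge0 ?sqr_ge0.
have vp : 0 < hnorm v ^+ 2 by rewrite exprn_gt0 // lt0r v0 hnorm_ge0.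
by rewrite -subr_ge0 -(pmulr_rge0 _ vp) [X in X - _]mulrC -hnorm_orth sqr_ge0.
Qed.

(** The Cauchy-Schwarz inequality between the components of [v] and [w]
    orthogonal to [u].  The difference of the two sides is [||u||^2] times the
    Gram determinant of [u], [v], [w]. *)
Lemma gram_cauchy_schwarz u v w (a := hnorm u ^+ 2) :
  normc (a%:C * herm v w - herm v u * herm u w) ^+ 2 <=
  (a * hnorm v ^+ 2 - normc (herm v u) ^+ 2) *
  (a * hnorm w ^+ 2 - normc (herm w u) ^+ 2).
Proof.
have [u0|u0] := eqVneq (hnorm u) 0.
  rewrite /a u0 (hnorm_eq0 u0) expr0n !herm0r !mul0r subrr Normc.normc0.
  by rewrite expr0n subr0 mulr0.
have up : 0 < a by rewrite exprn_gt0 // lt0r u0 hnorm_ge0.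
rewrite -(ler_pM2l (exprn_gt0 2 up)).
have := cauchy_schwarz (a%:C *: v - herm v u *: u) (a%:C *: w - herm w u *: u).
rewrite herm_orth !hnorm_orth Normc.normcM exprMn -/a.
rewrite (normc_real (ltW up)).
by move/le_trans; apply; rewrite le_eqVlt; apply/orP; left; apply/eqP; ring.
Qed.

(** The inner square root of the Lie norm; squared, it is the Gram determinant
    of [u] and its conjugate. *)
Definition lie_disc u : R := Num.sqrt (hnorm u ^+ 4 - normc (dot u u) ^+ 2).

Lemma normc_dot_le u : normc (dot u u) <= hnorm u ^+ 2.
Proof.
rewrite -ler_sqr ?nnegrE ?normc_ge0 ?sqr_ge0 //.
have := cauchy_schwarz u (cconj u).
by rewrite cconjK hnorm_cconj -expr2.
Qed.

Lemma sqr_lie_disc u :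
  lie_disc u ^+ 2 = (hnorm u ^+ 2) ^+ 2 - normc (dot u u) ^+ 2.
Proof.
rewrite sqr_sqrtr -?exprM // subr_ge0 (exprM _ 2 2).
by rewrite ler_sqr ?nnegrE ?normc_ge0 ?sqr_ge0 // normc_dot_le.
Qed.

Lemma sqr_L u : L u ^+ 2 = hnorm u ^+ 2 + lie_disc u.
Proof. by rewrite sqr_sqrtr // addr_ge0 ?sqr_ge0 ?sqrtr_ge0. Qed.

Lemma lie_disc_ge0 u : 0 <= lie_disc u. Proof. exact: sqrtr_ge0. Qed.

(** Cauchy-Schwarz for the components of [v] and of the conjugate of [u]
    orthogonal to [u]; on the right are the square roots of the Gram
    determinants of [u] with each of these two vectors. *)
Lemma dot_component_le u v :
  normc ((hnorm u ^+ 2)%:C * dot u v - dot u u * herm v u) <=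
  lie_disc u * Num.sqrt (hnorm u ^+ 2 * hnorm v ^+ 2 - normc (herm u v) ^+ 2).
Proof.
have q0 : 0 <= hnorm u ^+ 2 * hnorm v ^+ 2 - normc (herm u v) ^+ 2.
  by rewrite subr_ge0 cauchy_schwarz.
rewrite -ler_sqr ?nnegrE ?normc_ge0 ?mulr_ge0 ?lie_disc_ge0 ?sqrtr_ge0 //.
have := gram_cauchy_schwarz u v (cconj u).
rewrite exprMn sqr_lie_disc (sqr_sqrtr q0) cconjK hnorm_cconj -dotJ.
rewrite normc_conj /=.
rewrite -(normc_conj (herm v u)) hermJ -expr2 (dotC v u).
by rewrite [herm v u * _]mulrC [X in _ <= X -> _]mulrC.
Qed.
End Herm.

(** * The denominator does not vanish on the domain *)

(** The variables stand for [a = ||z||^2], [b = |z^2|], [al] with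
    [L(z)^2 = a + al], likewise [c], [d], [ga] for [w]; for
    [s1 + i s2 = z^2 * conj w^2] and [T = |z . conj w|^2].  The hypothesis on
    [4 * T] and the last one are what remains of the equation
    [2 (z . conj w) = 1 + s].  With [m = a c + al ga], the difference of the
    two sides of the last hypothesis factors as
    [2 a c (2 m - (1 + |s|^2)) (m - s1)], whose factors have opposite signs
    unless [m = s1]. *)
Lemma quadric_gap (R : realFieldType) (a c al ga b d T s1 s2 : R) :
  0 <= al -> 0 <= ga -> 0 <= b -> 0 <= d -> b <= a -> d <= c ->
  al ^+ 2 = a ^+ 2 - b ^+ 2 -> ga ^+ 2 = c ^+ 2 - d ^+ 2 ->
  (a + al) * (c + ga) < 1 ->
  s1 ^+ 2 + s2 ^+ 2 = (b * d) ^+ 2 ->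
  4 * T = (1 + s1) ^+ 2 + s2 ^+ 2 -> T <= a * c ->
  4 * ((c * b) ^+ 2 * T + (a * d) ^+ 2 * T)
     - 2 * a * c * (s1 * ((1 + s1) ^+ 2 - s2 ^+ 2) + 2 * s2 * ((1 + s1) * s2))
     <= 4 * ((c * al + a * ga) ^+ 2 * (a * c - T)) -> False.
Proof.
move=> al0 ga0 b0 d0 ba dc alE gaE LL sE TE Tac key.
have a0 : 0 <= a by lra.
have c0 : 0 <= c by lra.
pose m := a * c + al * ga.
have s0 : 0 <= b * d by rewrite mulr_ge0.
have bd : b * d <= a * c by rewrite ler_pM.
have ag : 0 <= al * ga by rewrite mulr_ge0.
have h1 : 0 <= a * ga by rewrite mulr_ge0.
have h2 : 0 <= al * c by rewrite mulr_ge0.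
have m1 : m < 1 by rewrite /m; nra.
have s1m : s1 <= b * d by nra.
have T1 : (1 - b * d) ^+ 2 <= 4 * T by rewrite TE; nra.
have ac0 : 0 < a * c by nra.
(* 2 m is the sum of (a + al) (c + ga) and (a - al) (c - ga), whose product is
   |s|^2, and 1 + x y > x + y for x, y < 1. *)
have mlt : 2 * m < 1 + (b * d) ^+ 2.
  have al_a : al <= a by nra.
  have ga_c : ga <= c by nra.
  have E1 : ((a + al) * (c + ga)) * ((a - al) * (c - ga)) = (b * d) ^+ 2.
    have -> : (a + al) * (c + ga) * ((a - al) * (c - ga)) =
        (a ^+ 2 - al ^+ 2) * (c ^+ 2 - ga ^+ 2) by ring.
    by rewrite alE gaE; ring.
  have E2 : 2 * m = (a + al) * (c + ga) + (a - al) * (c - ga).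
    by rewrite /m; ring.
  have : (a - al) * (c - ga) < 1 by rewrite /m in m1; nra.
  rewrite E2 -E1; nra.
have ac2 : 0 < 2 * (a * c) by lra.
have bE : b ^+ 2 = a ^+ 2 - al ^+ 2 by rewrite alE; ring.
have dE : d ^+ 2 = c ^+ 2 - ga ^+ 2 by rewrite gaE; ring.
have s2E : s2 ^+ 2 = (b * d) ^+ 2 - s1 ^+ 2 by rewrite -sE; ring.
have TT : T = ((1 + s1) ^+ 2 + s2 ^+ 2) / 4 by rewrite -TE; field.
have fac : 0 <= (2 * m - (1 + (b * d) ^+ 2)) * (m - s1).
  rewrite -(pmulr_rge0 _ ac2); move: key; rewrite -subr_ge0; congr (0 <= _).
  rewrite (_ : 2 * s2 * _ = 2 * (1 + s1) * s2 ^+ 2); last by ring.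
  rewrite TT s2E /m !exprMn bE dE.
  by field.
(* Now s1 <= |s| <= a c <= m <= s1: all are equal, and 4 T <= 4 a c becomes
   (1 - m)^2 <= 0, whereas m < 1. *)
have ms : m <= s1 by nra.
have bdm : b * d = m by rewrite /m in ms *; lra.
have acm : a * c = m by rewrite /m in ms bdm *; lra.
have s1E : s1 = m by lra.
nra.
Qed.

Section Denominator.
Variables (R : realType) (n : nat).
Implicit Types (x y : R[i]) (z w : 'rV[R[i]]_n).
Local Notation normc := (@Normc.normc R).

(** The base of the power in [kernel_denom], before the square root. *)
Definition denom_base z w : R[i] :=
  dot (cconj w) (cconj w) * dot z z - 2 * dot (cconj w) z + 1.

Lemma sqr_lt1_prod (x y : R) : 0 <= x -> 0 <= y -> x * y < 1 ->
  x ^+ 2 * y ^+ 2 < 1.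
Proof. by move=> x0 y0 xy; rewrite -exprMn expr_lt1 // mulr_ge0. Qed.

Lemma L_ge0 z : 0 <= L z. Proof. exact: sqrtr_ge0. Qed.

Lemma sqr_L_lt1 z w : L z * L w < 1 ->
  (hnorm z ^+ 2 + lie_disc z) * (hnorm w ^+ 2 + lie_disc w) < 1.
Proof. by move=> zw; rewrite -!sqr_L sqr_lt1_prod ?L_ge0. Qed.

Lemma normc_ratio_lt1 z w : L z * L w < 1 ->
  normc (dot z z * dot (cconj w) (cconj w)) < 1.
Proof.
move=> /sqr_L_lt1; apply: le_lt_trans.
rewrite Normc.normcM -dotJ normc_conj ler_pM ?normc_ge0 //.
  by rewrite (le_trans (normc_dot_le _)) // lerDl lie_disc_ge0.
by rewrite (le_trans (normc_dot_le _)) // lerDl lie_disc_ge0.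
Qed.

(** [dot_component_le] says how far [dot z w] is from a multiple of the
    conjugate of [t], and, with the vectors exchanged, from a multiple of [t].
    The triangle inequality eliminates [dot z w]; the statement is its square,
    expanded. *)
Lemma dot_cross_le z w (a := hnorm z ^+ 2) (c := hnorm w ^+ 2)
    (t := dot z (cconj w)) (s := dot z z * dot (cconj w) (cconj w)) :
  (c * normc (dot z z)) ^+ 2 * normc t ^+ 2
  + (a * normc (dot w w)) ^+ 2 * normc t ^+ 2
  - 2 * (a * c * complex.Re (s * t^*%C ^+ 2)) <=
  (c * lie_disc z + a * lie_disc w) ^+ 2 * (a * c - normc t ^+ 2).
Proof.
have q0 : 0 <= a * c - normc t ^+ 2 by rewrite subr_ge0 cauchy_schwarz.
have a0 : 0 <= a := sqr_ge0 _.
have c0 : 0 <= c := sqr_ge0 _.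
set X := c%:C * dot z z * t^*%C; set Y := a%:C * dot w w * t.
have XY : normc (X - Y) <=
    (c * lie_disc z + a * lie_disc w) * Num.sqrt (a * c - normc t ^+ 2).
  have -> : X - Y = a%:C * (c%:C * dot w z - dot w w * t) +
      (- (c%:C * (a%:C * dot z w - dot z z * t^*%C))).
    by rewrite (dotC w z) /X /Y; ring.
  apply: (le_trans (le_normcD _ _)); rewrite normcN !Normc.normcM.
  rewrite !normc_real // mulrDl addrC -!(mulrA _ _ (Num.sqrt _)).
  apply: lerD; apply: ler_wpM2l => //.
    by rewrite hermJ; apply: dot_component_le.
  rewrite (mulrC a) -(normc_conj t) hermJ.
  exact: dot_component_le.
have B0 : 0 <= c * lie_disc z + a * lie_disc w.
  by rewrite addr_ge0 // mulr_ge0 ?lie_disc_ge0.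
move: XY; rewrite -ler_sqr ?nnegrE ?normc_ge0 ?mulr_ge0 ?sqrtr_ge0 //.
rewrite exprMn (sqr_sqrtr q0); apply: le_trans.
rewrite sqr_normcB /X /Y !Normc.normcM !normc_real // normc_conj.
rewrite 2![(_ * normc t) ^+ 2]exprMn lerD2l lerN2.
rewrite (_ : _ * (_ * t)^*%C = (a * c)%:C * (s * t^*%C ^+ 2)).
  by case: (s * _) => x y; rewrite /= mul0r subr0.
have conjZ (x : R[i]) : (a%:C * x)^*%C = a%:C * x^*%C.
  by case: x => p q; apply/eqP; rewrite eq_complex /=; apply/andP; split;
     apply/eqP; ring.
rewrite [(a * c)%:C]rmorphM -(mulrA a%:C) conjZ (rmorphM (@conjc R)) /=.
rewrite (dotJ w w) /s; ring.
Qed.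

Lemma denom_base_neq0 z w : L z * L w < 1 -> denom_base z w != 0.
Proof.
move=> zw; apply/eqP => D0.
set s := dot z z * dot (cconj w) (cconj w).
set t := dot z (cconj w).
have ts : 2 * t = 1 + s.
  apply/eqP; rewrite -subr_eq0 -oppr_eq0 -[X in _ == X]D0 /denom_base dotC -/t.
  by apply/eqP; rewrite /s; ring.
have NT : 4 * normc t ^+ 2 = (1 + complex.Re s) ^+ 2 + complex.Im s ^+ 2.
  have -> : 4 * normc t ^+ 2 = normc (2 * t) ^+ 2.
    rewrite Normc.normcM exprMn; congr (_ * _).
    by rewrite -(rmorph_nat (real_complex R)) normc_real // -natrX.
  by rewrite ts sqr_normcE; case: s {ts} => s1 s2 /=; rewrite add0r.
have Rt : 4 * complex.Re (s * t^*%C ^+ 2) =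
    complex.Re s * ((1 + complex.Re s) ^+ 2 - complex.Im s ^+ 2)
    + 2 * complex.Im s * ((1 + complex.Re s) * complex.Im s).
  have -> : 4 * complex.Re (s * t^*%C ^+ 2) =
      complex.Re (s * (1 + s)^*%C ^+ 2).
    rewrite -ts; case: (t) (s) => t1 t2 [s1 s2] /=; ring.
  by case: (s) => s1 s2 /=; ring.
have := dot_cross_le z w; cbv zeta; rewrite -/s -/t => key.
apply: (@quadric_gap R (hnorm z ^+ 2) (hnorm w ^+ 2) (lie_disc z) (lie_disc w)
  (normc (dot z z)) (normc (dot w w)) (normc t ^+ 2)
  (complex.Re s) (complex.Im s));
  rewrite ?lie_disc_ge0 ?normc_ge0 ?normc_dot_le ?sqr_lie_disc ?sqr_L_lt1 //.
- by rewrite -sqr_normcE /s Normc.normcM -dotJ normc_conj.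
- exact: cauchy_schwarz.
by rewrite -Rt; move: key; set F := complex.Re _; lra.
Qed.
End Denominator.

(** * Continuity and uniform bounds *)

Section Continuity.
Variables (R : realType) (n : nat).
Implicit Types (x y : R[i]).
Local Notation normc := (@Normc.normc R).
Local Notation V := 'rV[R[i]]_n.

Lemma ball_normc x (e : R) y : ball x e%:C y = (normc (x - y) < e) :> Prop.
Proof. by rewrite -ball_normE /= ltcR. Qed.

Lemma continuous_normc : continuous normc.
Proof.
move=> x; apply/(@cvgrPdist_lt _ _ _ _ (nbhs_filter x)) => e e0.
have ec : 0 < e%:C by rewrite ltcR.
have := nbhsx_ballx x _ ec.
apply: filterS => y; rewrite ball_normc; apply: le_lt_trans.
rewrite ler_norml lerB_normc andbT lerNl opprB (le_trans (lerB_normc _ _)) //.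
by rewrite -opprB normcN.
Qed.

Lemma continuous_conjc : continuous (@conjc R : R[i] -> R[i]).
Proof.
move=> x; apply/(@cvgrPdist_lt _ _ _ _ (nbhs_filter x)) => e e0.
have := nbhsx_ballx x _ e0.
apply: filterS => y; rewrite -ball_normE /=.
by rewrite -(rmorphB (@conjc R)) normcJ.
Qed.

Lemma continuous_dot (T : topologicalType) (f g : T -> V) :
  (forall j, continuous (fun t : T => f t 0 j)) ->
  (forall j, continuous (fun t : T => g t 0 j)) ->
  continuous (fun t : T => dot (f t) (g t)).
Proof.
move=> fc gc; rewrite /dot; apply: continuous_big => [|j _ t].
  by move=> t; apply: cvgD; [exact: cvg_fst|exact: cvg_snd].
by apply: cvgM; [exact: fc|exact: gc].
Qed.

Lemma continuous_fst_coord j : continuous (fun zw : V * V => zw.1 0 j : R[i]).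
Proof.
move=> zw.
apply: (@continuous_comp _ _ _ fst (fun M : V => M 0 j)); first exact: cvg_fst.
exact: coord_continuous.
Qed.

Lemma continuous_snd_coord j :
  continuous (fun zw : V * V => cconj zw.2 0 j : R[i]).
Proof.
rewrite (_ : (fun _ => _) = (@conjc R : R[i] -> R[i]) \o
    ((fun M : V => M 0 j) \o snd)); last first.
  by apply/funext => zw; rewrite /= mxE.
move=> zw; apply: continuous_comp; last exact: continuous_conjc.
apply: continuous_comp; first exact: cvg_snd.
exact: coord_continuous.
Qed.

Lemma continuous_ratio : continuous
  (fun zw : V * V => dot zw.1 zw.1 * dot (cconj zw.2) (cconj zw.2)).
Proof.
move=> zw; apply: cvgM.
  exact: (continuous_dot continuous_fst_coord continuous_fst_coord).
exact: (continuous_dot continuous_snd_coord continuous_snd_coord).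
Qed.

Lemma continuous_denom_base :
  continuous (fun zw : V * V => denom_base zw.1 zw.2).
Proof.
rewrite /denom_base => zw.
apply: cvgD; last exact: cvg_cst.
apply: cvgB.
  apply: cvgM.
    exact: (continuous_dot continuous_snd_coord continuous_snd_coord).
  exact: (continuous_dot continuous_fst_coord continuous_fst_coord).
apply: cvgM; first exact: cvg_cst.
exact: (continuous_dot continuous_snd_coord continuous_fst_coord).
Qed.

End Continuity.

(** A strict bound on a compact set can be made uniform because the maximum is
    attained; the empty set is allowed. *)
Lemma compact_lt_uniform (R : realType) (T : topologicalType) (K : set T)
    (f : T -> R) (b : R) : compact K -> continuous f ->
  (forall t, K t -> f t < b) -> exists2 r, r < b & forall t, K t -> f t <= r.
Proof.
move=> cK cf fb.
have [->|K0] := eqVneq K set0.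
  by exists (b - 1) => //; rewrite ltrBlDr ltrDl.
have /set0P K0' := K0.
have [|c Kc fc] := compact_EVT_max K0' cK (f := f).
  exact: continuous_subspaceT.
exists (f c); first by apply: fb; rewrite inE in Kc.
by move=> t Kt; apply: fc; rewrite inE.
Qed.

(** The bound passes through the principal root without any continuity of that
    root, which is discontinuous along the negative reals. *)
Lemma normc_kernel_denom (R : realType) n (z w : 'rV[R[i]]_n) (d : R) :
  0 <= d -> d <= Normc.normc (denom_base z w) ->
  Num.sqrt d ^+ n <= Normc.normc (kernel_denom z w).
Proof.
move=> d0 dz; rewrite /kernel_denom.
rewrite normcX lerXn2r ?nnegrE ?sqrtr_ge0 ?normc_ge0 //.
rewrite -ler_sqr ?nnegrE ?sqrtr_ge0 ?normc_ge0 // sqr_sqrtr //.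
by rewrite expr2 -Normc.normcM -expr2 sqr_sqrtc.
Qed.

(** The uniformity of [R[i]] has complex radii, but a positive complex number is
    a positive real one. *)
Lemma uniform_normc (R : realType) (T : choiceType) (K : set T)
    (f : nat -> T -> R[i]) (g : T -> R[i]) :
  (forall e : R, 0 < e -> \forall p \near \oo,
    forall t, K t -> Normc.normc (g t - f p t) < e) ->
  {uniform K, f @ \oo --> g}.
Proof.
move=> fg P /uniform_nbhs[E [entE EP]].
move: entE; rewrite -entourage_ballE => -[e /= e0 eE].
have eR : e = (complex.Re e)%:C by rewrite RRe_real // ger0_real // ltW.
have Re0 : 0 < complex.Re e by rewrite -ltcR -eR.
apply: filterS (fg _ Re0) => p fp; apply: EP => t Kt.
by apply: eE => /=; rewrite eR ball_normc; apply: fp.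
Qed.

(** * Convergence *)

Unset Implicit Arguments.

Theorem proposition11 (R : realType) (n : nat) (hn : (0 < n)%N)
    (K : set ('rV[R[i]]_n * 'rV[R[i]]_n)) (hK : compact K)
    (hKLD : K `<=` @LD R n) :
  {uniform K, (fun (p : nat) (zw : 'rV[R[i]]_n * 'rV[R[i]]_n) =>
                 poisson p zw.1 zw.2) @ \oo -->
              (fun zw : 'rV[R[i]]_n * 'rV[R[i]]_n => cauchy_hua zw.1 zw.2)}.
Proof.
have normc_cont (g : 'rV[R[i]]_n * 'rV[R[i]]_n -> R[i]) : continuous g ->
    continuous (fun zw => Normc.normc (g zw)).
  by move=> cg zw; apply: continuous_comp; [exact: cg|exact: continuous_normc].
have [r r1 sr] := compact_lt_uniform hK (normc_cont _ (@continuous_ratio R n))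
  (fun zw Kzw => normc_ratio_lt1 (hKLD zw Kzw)).
have base0 zw : K zw -> - Normc.normc (denom_base zw.1 zw.2) < 0.
  move=> /hKLD/denom_base_neq0 D0; rewrite oppr_lt0 lt0r normc_ge0 andbT.
  by apply: contra_neq D0 => /Normc.eq0_normc.
(* A lower bound of |f| is an upper bound of its opposite. *)
have [d' d0 dK] := compact_lt_uniform hK
  (f := fun zw => - Normc.normc (denom_base zw.1 zw.2))
  (fun zw => cvgN (normc_cont _ (@continuous_denom_base R n) zw)) base0.
pose d := - d'.
have {}d0 : 0 < d by rewrite oppr_gt0.
apply: uniform_normc => e e0.
have [K0|/set0P[zw0 Kzw0]] := eqVneq K set0.
  by rewrite K0; apply: nearW => p zw.
have r0 : 0 <= r := le_trans (normc_ge0 _) (sr _ Kzw0).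
have C0 : 0 < Num.sqrt d ^+ n by rewrite exprn_gt0 ?sqrtr_gt0.
have rlim : (fun p => r ^+ p) @ \oo --> (0 : R).
  by apply: cvg_expr; rewrite ger0_norm.
have eC : 0 < e * Num.sqrt d ^+ n by rewrite mulr_gt0.
have /cvgrPdist_lt/(_ _ eC) := rlim.
apply: filterS => p; rewrite sub0r normrN ger0_norm ?exprn_ge0 // => rp zw Kzw.
have D : Num.sqrt d ^+ n <= Normc.normc (kernel_denom zw.1 zw.2).
  by apply: (normc_kernel_denom (ltW d0)); rewrite /d lerNl; apply: dK.
rewrite /cauchy_hua /poisson -mulrBl opprB addrC subrK.
rewrite Normc.normcM Normc.normcV ltr_pdivrMr ?(lt_le_trans C0) // normcX.
apply: (le_lt_trans (lerXn2r _ _ _ (sr _ Kzw))); rewrite ?nnegrE ?normc_ge0 //.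
by apply: (lt_le_trans rp); rewrite ler_pM2l.
Qed.
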